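(* Let $a_4(n)$ denote the number of $4$-core partitions of $n$. For all $\alpha\ge1$, $\beta\ge0$, $n\ge0$ and $i\in\{1,2\}$, $$a_4\left(3^{2\alpha}n+\frac{(8i+15)\cdot3^{2\alpha-1}-5}{8}\right)\equiv0\pmod2$$ and $$a_4\left(\frac{5\cdot3^{2\beta}-5}{8}\right)\equiv1\pmod2.$$
   Context: A partition is a $t$-core partition if none of its hook lengths is divisible by $t$; $a_t(n)$ is the number of $t$-core partitions of $n$. Its generating function (Garvan–Kim–Stanton) is $\sum_{n\ge0}a_t(n)q^n=\prod_{n\ge1}\frac{(1-q^{tn})^t}{1-q^n}$. *)

(* Defs.v *)
From mathcomp Require Import all_boot.

Set Implicit Arguments.
Unset Strict Implicit.
Unset Printing Implicit Defensive.

(* A partition is the list of its (positive) parts in weakly decreasing order;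
   parts and cells of the Young diagram are indexed from 0. *)
Definition is_partition (la : seq nat) : bool :=
  sorted geq la && (0 \notin la).

Definition is_partition_of (n : nat) (la : seq nat) : bool :=
  is_partition la && (sumn la == n).

Definition in_diagram (la : seq nat) (i j : nat) : bool := j < nth 0 la i.

Definition conj_part (la : seq nat) (j : nat) : nat := count (ltn j) la.

Definition arm (la : seq nat) (i j : nat) : nat := nth 0 la i - j.+1.

Definition leg (la : seq nat) (i j : nat) : nat := conj_part la j - i.+1.

Definition hook_length (la : seq nat) (i j : nat) : nat :=
  (arm la i j + leg la i j).+1.

Definition hook_lengths (la : seq nat) : seq nat :=
  [seq hook_length la i j | i <- iota 0 (size la), j <- iota 0 (nth 0 la i)].

Definition is_core (t : nat) (la : seq nat) : bool :=
  all (fun h => ~~ (t %| h)) (hook_lengths la).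

(* A partition of n has at most n parts, each at most n, so all of them live in
   the finite type of sequences of size at most n over {0, ..., n}; see
   num_coresP below. *)
Definition num_cores (t n : nat) : nat :=
  #|[set p : n.-bseq 'I_n.+1 |
      is_partition_of n (map val p) && is_core t (map val p)]|.

Lemma is_coreP (t : nat) (la : seq nat) :
  reflect (forall i j, in_diagram la i j -> ~~ (t %| hook_length la i j))
          (is_core t la).
Proof.
apply: (iffP allP) => [H i j Hij | H h /allpairsPdep [i [j [_ Hj ->]]]].
  apply: H; apply/allpairsPdep; exists i, j; split=> //; rewrite mem_iota //=.
  by rewrite add0n ltnNge; apply/negP=> Hi; move: Hij; rewrite /in_diagram nth_default.
by apply: H; rewrite mem_iota in Hj.
Qed.

Lemma partition_bounds (n : nat) (la : seq nat) :
  is_partition_of n la -> size la <= n /\ all (fun x => x <= n) la.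
Proof.
case/andP=> /andP[_ H0] /eqP <- {n}; elim: la H0 => //= x s IH.
rewrite inE negb_or eq_sym -lt0n => /andP[x0 /IH [H1 H2]]; split.
  by rewrite -add1n leq_add.
rewrite leq_addr /=; apply: sub_all H2 => y Hy.
exact: leq_trans Hy (leq_addl _ _).
Qed.

Lemma num_coresP (t n : nat) (s : seq (seq nat)) :
  uniq s ->
  (forall la, (la \in s) = is_partition_of n la && is_core t la) ->
  num_cores t n = size s.
Proof.
move=> us Hs; rewrite /num_cores cardE.
set A := [set p : n.-bseq 'I_n.+1 | _].
pose f (p : n.-bseq 'I_n.+1) : seq nat := map val p.
have finj : injective f by move=> p q /(inj_map val_inj) /val_inj.
rewrite -(size_map f); apply: perm_size; apply: uniq_perm => //.
  by rewrite map_inj_uniq // enum_uniq.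
move=> la; rewrite Hs; apply/mapP/idP => [[p Hp ->]|Hla].
  by move: Hp; rewrite mem_enum inE.
have [/partition_bounds [sz bd] _] := andP Hla.
have sz' : size (map (@inord n) la) <= n by rewrite size_map.
have E : la = f (Bseq sz').
  rewrite /f /= -map_comp -[LHS]map_id; apply/eq_in_map => x xla /=.
  by rewrite inordK // ltnS; move/allP: bd; apply.
by exists (Bseq sz') => //; rewrite mem_enum inE -/(f _) -E.
Qed.

(* The truncated subtraction and Euclidean quotient in the theorem are exact. *)
Lemma index_exact (a i : nat) :
  1 <= a ->
  8 * (((8 * i + 15) * 3 ^ (2 * a - 1) - 5) %/ 8) + 5
    = (8 * i + 15) * 3 ^ (2 * a - 1).
Proof.
have E k : 3 ^ (2 * k) = 1 %[mod 8] by rewrite expnM -modnXm exp1n.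
move=> a1; set N := (8 * i + 15) * _.
have N5 : 5 <= N.
  apply: leq_trans (leq_pmulr _ _); last by rewrite expn_gt0.
  exact: leq_trans (leq_addl _ _).
have dN : 8 %| N - 5.
  rewrite -eqn_mod_dvd // /N; case: a a1 {N N5} => // a _.
  rewrite mulnS addSn subn1 /= add1n expnS mulnA.
  by rewrite -modnMmr E modnMmr muln1 mulnDl -mulnA -modnDml modnMr.
by rewrite mulnC divnK // subnK.
Qed.

Lemma odd_index_exact (b : nat) :
  8 * ((5 * 3 ^ (2 * b) - 5) %/ 8) + 5 = 5 * 3 ^ (2 * b).
Proof.
have E : 3 ^ (2 * b) = 1 %[mod 8] by rewrite expnM -modnXm exp1n.
have le5 : 5 <= 5 * 3 ^ (2 * b) by rewrite leq_pmulr // expn_gt0.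
by rewrite mulnC divnK ?subnK // -eqn_mod_dvd // -modnMmr E.
Qed.

(* Main.v *)
Require Import Defs.
From mathcomp Require Import all_boot zify.

(* Place a partition of n on a t-runner abacus with t n beads at positions
   0, ..., 2 t n - 1: row i gives the bead la_i + (t n - 1 - i), column j gives
   the gap t n + j - la'_j, and hook lengths are the differences bead - gap.
   Hence la is a t-core iff the beads are pushed down on every runner, i.e. iff
   the bead set is determined by the runner lengths m_0, ..., m_(t-1) <= 2 n.

   Conjugation is the involution m_r |-> 2 n - m_(t-1-r), so a_4(n) has the
   parity of the number of vectors (n + u, n + v, n - v, n - u) of size n.
   Their size condition 4 u^2 - 3 u + 4 v^2 - v = n is
   (8 u - 3)^2 + (8 v - 1)^2 = 2 (8 n + 5).  If 3 divides 8 n + 5 to an odd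
   power there is no solution; if 8 n + 5 = 5 * 9^b, descent by 3 leaves
   10 = 1 + 9, and residues mod 8 fix the order and the signs. *)

(** * Beads and gaps of a partition *)

(** Both sides say that the cell [(i, j)] lies in the diagram, read once along its row and once
    along its column. *)
Lemma ltn_nth_conj_part (la : seq nat) (i j : nat) :
  sorted geq la -> (j < nth 0 la i) = (i < conj_part la j).
Proof.
elim: la i => [|x s IH] i /=; first by rewrite nth_nil.
move=> xs; rewrite /conj_part /= -/(conj_part s j).
have [jx|xj] := ltnP j x; first by case: i => //= i; rewrite IH ?(path_sorted xs).
have -> : conj_part s j = 0.
  apply/eqP; rewrite -leqn0 leqNgt -has_count; apply/hasPn => y ys /=.
  move: xs; rewrite (path_sortedE (rev_trans leq_trans)) => /andP[/allP/(_ y ys) yx _].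
  by rewrite -leqNgt (leq_trans yx xj).
case: i => [|i] /=; first by rewrite ltnNge xj.
apply: contraTF xj => ji; rewrite -ltnNge (leq_trans ji) //.
have si : i < size s by rewrite ltnNge; apply: contraL ji => /(nth_default 0) ->.
move: xs; rewrite (path_sortedE (rev_trans leq_trans)) => /andP[/allP xs _].
exact/xs/mem_nth.
Qed.

Lemma leq_nth_part (la : seq nat) (i j : nat) :
  sorted geq la -> i <= j -> nth 0 la j <= nth 0 la i.
Proof.
move=> sla ij; rewrite leqNgt ltn_nth_conj_part // -leqNgt.
apply: leq_trans ij; rewrite leqNgt -ltn_nth_conj_part //.
by rewrite ltnn.
Qed.

(** The default 0 of [nth] pads [la] with empty rows, which give the lowest beads; all bead sets
    thus have exactly [L] elements. *)
Definition beta (L : nat) (la : seq nat) : seq nat :=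
  mkseq (fun i => nth 0 la i + (L - i.+1)) L.

Definition gamma (L : nat) (la : seq nat) : seq nat :=
  mkseq (fun j => L + j - conj_part la j) L.

Lemma sumn_beta (L : nat) (la : seq nat) : size la <= L ->
  sumn (beta L la) = sumn la + \sum_(i < L) i.
Proof.
move=> la_size; rewrite sumnE big_map -{1}[L]subn0 -/(index_iota 0 L) big_mkord big_split /=.
congr (_ + _).
  rewrite [in RHS](sumnE la) (big_nth 0) big_mkord (big_ord_widen L _ la_size) [in RHS]big_mkcond.
  by apply: eq_bigr => i _; case: ltnP => // /(nth_default 0).
by rewrite (reindex_inj rev_ord_inj) /=; apply: eq_bigr => i _; have := ltn_ord i; lia.
Qed.

Section BetaSet.

Variables (L : nat) (la : seq nat).
Hypotheses (la_sorted : sorted geq la) (la_size : size la <= L).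

Lemma beta_sorted : sorted gtn (beta L la).
Proof.
apply/(sortedP 0) => i; rewrite size_mkseq => iL.
rewrite !nth_mkseq ?(ltnW iL) //=.
by have := leq_nth_part la i i.+1 la_sorted (leqnSn i); lia.
Qed.

Lemma conj_part_leq (j : nat) : conj_part la j <= L.
Proof. exact: leq_trans (count_size _ _) la_size. Qed.

Lemma conj_part_antimono (i j : nat) : i <= j -> conj_part la j <= conj_part la i.
Proof. by move=> ij; apply: sub_count => x /=; apply: leq_ltn_trans. Qed.

(** For a cell, [nth 0 la i] exceeds [j] and [conj_part la j] exceeds [i]; off the diagram both
    inequalities fail. Hence the order of gap and bead tests for a cell, and the two never
    coincide. *)
Lemma beta_gamma_ltn (i j : nat) : i < L ->
  (L + j - conj_part la j < nth 0 la i + (L - i.+1)) = (j < nth 0 la i).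
Proof.
move=> iL; have cL := conj_part_leq j.
by have := ltn_nth_conj_part la i j la_sorted; lia.
Qed.

Lemma beta_gamma_neq (i j : nat) : i < L ->
  L + j - conj_part la j <> nth 0 la i + (L - i.+1).
Proof.
move=> iL; have cL := conj_part_leq j.
by have := ltn_nth_conj_part la i j la_sorted; lia.
Qed.

Lemma hook_length_beta_gamma (i j : nat) : i < L -> j < nth 0 la i ->
  hook_length la i j = nth 0 la i + (L - i.+1) - (L + j - conj_part la j).
Proof.
move=> iL ji; have cL := conj_part_leq j.
by have := ltn_nth_conj_part la i j la_sorted; rewrite /hook_length /arm /leg; lia.
Qed.

Lemma gamma_uniq : uniq (gamma L la).
Proof.
rewrite map_inj_in_uniq ?iota_uniq // => i j _ _.
have := conj_part_leq i; have := conj_part_leq j.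
have [ij|/ltnW ij] := leqP i j; have := conj_part_antimono _ _ ij; lia.
Qed.

Lemma beta_uniq : uniq (beta L la).
Proof.
apply: sorted_uniq beta_sorted; first by move=> y x z /= xy yz; apply: ltn_trans xy.
by move=> x /=; rewrite ltnn.
Qed.

Lemma beta_bound (x : nat) : all (leq^~ L) la -> x \in beta L la -> x < 2 * L.
Proof.
move=> /allP la_bd /mapP[i]; rewrite mem_iota => /= iL ->.
have : nth 0 la i <= L.
  have [/(mem_nth 0)/la_bd//|/(nth_default 0) -> //] := ltnP i (size la).
lia.
Qed.

(** Counting: [L] distinct beads and [L] distinct gaps, disjoint and below [2 * L], must fill all
    positions. *)
Lemma mem_gamma (x : nat) : all (leq^~ L) la ->
  x < 2 * L -> (x \in gamma L la) = (x \notin beta L la).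
Proof.
move=> la_bd xL.
have disj y : y \in gamma L la -> y \notin beta L la.
  case/mapP=> j _ ->; apply/mapP => -[i]; rewrite mem_iota => /= iL.
  exact: beta_gamma_neq.
have sub : {subset beta L la ++ gamma L la <= iota 0 (2 * L)}.
  move=> y; rewrite mem_cat mem_iota => /orP[/beta_bound-> //|].
  by case/mapP=> j; rewrite mem_iota /= => jL ->; lia.
have u : uniq (beta L la ++ gamma L la).
  rewrite cat_uniq beta_uniq gamma_uniq andbT /=.
  by apply/hasPn => y /disj.
have [|_ /(_ x)] := uniq_min_size u sub.
  by rewrite size_iota size_cat !size_mkseq; lia.
rewrite mem_cat mem_iota /= xL => /esym.
by case: (x \in beta L la) (@disj x) => //=; case: (_ \in _) => // /(_ isT).
Qed.

(** A bead at [x + t] above a gap at [x] is a cell of hook length [t]. Conversely, if some hook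
    length is [k * t], sliding its bead down [k] times by closure would put a bead on its gap. *)
Lemma is_core_beta (t : nat) : 0 < t -> all (leq^~ L) la ->
  reflect (forall x, x + t \in beta L la -> x \in beta L la) (is_core t la).
Proof.
move=> t0 la_bd; apply: (iffP (is_coreP t la)) => [core x xt | clos i j ij].
  apply/negPn; rewrite -mem_gamma //; last first.
    by apply: leq_ltn_trans (leq_addr t x) _; apply: beta_bound.
  apply/mapP => -[j]; rewrite mem_iota /= => jL xE.
  case/mapP: xt => i; rewrite mem_iota /= => iL xtE.
  have ji : j < nth 0 la i by rewrite -beta_gamma_ltn // -xE -xtE; lia.
  by have := core i j ji; rewrite hook_length_beta_gamma // -xE -xtE addKn dvdnn.
have iL : i < L.
  move: (ij); apply: contraLR; rewrite -leqNgt => Li.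
  by rewrite /in_diagram nth_default // (leq_trans la_size).
have jL : j < L.
  apply: (leq_trans ij); have si : i < size la.
    by move: (ij); apply: contraLR; rewrite -leqNgt => Li; rewrite /in_diagram nth_default.
  by apply: (allP la_bd); apply: mem_nth.
apply/negP; rewrite hook_length_beta_gamma // => /dvdnP[k kE].
have down c y : y + c * t \in beta L la -> y \in beta L la.
  by elim: c y => [|c IH] y; rewrite ?addn0 // mulSn addnA addnAC => /clos/IH.
have g : L + j - conj_part la j \in gamma L la by apply: map_f; rewrite mem_iota.
have lt : j < nth 0 la i := ij; rewrite -beta_gamma_ltn // in lt.
have : L + j - conj_part la j \in beta L la.
  apply: (down k); rewrite -kE subnKC ?(ltnW lt) //.
  by apply: map_f; rewrite mem_iota.
case/mapP=> i'; rewrite mem_iota /= => i'L; exact: beta_gamma_neq.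
Qed.

End BetaSet.

(** * Recovering a partition from its beads *)

Definition part_of_beta (s : seq nat) : seq nat :=
  [seq y <- mkseq (fun i => nth 0 s i - (size s - i.+1)) (size s) | 0 < y].

(** The zeros of a decreasing sequence form its tail, so deleting them is invisible to [nth] with
    default 0. *)
Lemma nth_filter_pos (s : seq nat) (i : nat) :
  sorted geq s -> nth 0 [seq y <- s | 0 < y] i = nth 0 s i.
Proof.
elim: s i => //= x s IH i xs.
have [x0|] := posnP x; last by case: i => //= i; rewrite IH ?(path_sorted xs).
have z y : y \in s -> y = 0.
  move: xs; rewrite (path_sortedE (rev_trans leq_trans)) x0 => /andP[/allP xs _] /xs /=.
  by rewrite leqn0 => /eqP.
rewrite (_ : filter _ s = [::]); last first.
  by apply/eqP; rewrite -[_ == _]negbK -has_filter; apply/hasPn => y /z ->.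
rewrite nth_nil; case: i => //= i.
have [/(mem_nth 0)/z->//|/(nth_default 0) -> //] := ltnP i (size s).
Qed.

(** The entries after position [i] are distinct naturals below the entry at [i]. This makes the
    truncated subtraction in [part_of_beta] exact. *)
Lemma sorted_gtn_nth (s : seq nat) (i : nat) :
  sorted gtn s -> i < size s -> size s - i.+1 <= nth 0 s i.
Proof.
elim: s i => //= x [|y s] IH [|i] //= /andP[yx ys] iL.
  by have := IH 0 ys isT; rewrite /=; lia.
by have := IH i ys iL; rewrite /=; lia.
Qed.

Section PartOfBeta.

Variable s : seq nat.
Hypothesis s_sorted : sorted gtn s.

Lemma nth_part_of_beta (i : nat) :
  nth 0 (part_of_beta s) i = nth 0 s i - (size s - i.+1).
Proof.
rewrite nth_filter_pos; last first.
  apply/(sortedP 0) => j; rewrite size_mkseq => jL.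
  rewrite !nth_mkseq ?(ltnW jL) //=.
  have /(sortedP 0)/(_ j jL) /= := s_sorted.
  lia.
have [iL|Li] := ltnP i (size s); first by rewrite nth_mkseq.
by rewrite !nth_default ?size_mkseq.
Qed.

Lemma part_of_beta_sorted : sorted geq (part_of_beta s).
Proof.
apply: sorted_filter; first exact: rev_trans leq_trans.
apply/(sortedP 0) => j; rewrite size_mkseq => jL.
rewrite !nth_mkseq ?(ltnW jL) //=.
have /(sortedP 0)/(_ j jL) /= := s_sorted.
lia.
Qed.

Lemma part_of_beta_partition : is_partition (part_of_beta s).
Proof. by rewrite /is_partition part_of_beta_sorted mem_filter. Qed.

Lemma size_part_of_beta : size (part_of_beta s) <= size s.
Proof. by rewrite size_filter (leq_trans (count_size _ _)) ?size_mkseq. Qed.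

Lemma part_of_betaK : beta (size s) (part_of_beta s) = s.
Proof.
apply: (@eq_from_nth _ 0); rewrite size_mkseq // => i iL.
by rewrite nth_mkseq // nth_part_of_beta subnK // sorted_gtn_nth.
Qed.

End PartOfBeta.

Lemma betaK (L : nat) (la : seq nat) :
  is_partition la -> size la <= L -> part_of_beta (beta L la) = la.
Proof.
move=> /andP[la_sorted la0] la_size; rewrite /part_of_beta size_mkseq.
(* Before filtering, the differences are [la] padded to length [L]; the filter then removes exactly
   the padding, since the parts of [la] are positive. *)
have -> : mkseq (fun i => nth 0 (beta L la) i - (L - i.+1)) L
        = la ++ nseq (L - size la) 0.
  apply: (@eq_from_nth _ 0); rewrite size_mkseq ?size_cat ?size_nseq ?subnKC // => i iL.
  rewrite !nth_mkseq // addnK nth_cat nth_nseq.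
  by case: ltnP => // ?; rewrite nth_default //; case: ifP.
rewrite filter_cat [X in _ ++ X](_ : _ = [::]) ?cats0.
  by apply/all_filterP/allP => x; rewrite lt0n; apply: contraTneq => ->.
by elim: (L - _).
Qed.

(** * The abacus and its runners *)

(** The list is decreasing so that it can be compared with [beta] as a sequence, not only as a
    set. *)
Definition abacus (t K : nat) (m : nat -> nat) : seq nat :=
  [seq x <- rev (iota 0 (t * K)) | x %/ t < m (x %% t)].

Lemma mem_abacus (t K : nat) (m : nat -> nat) (r k : nat) : r < t -> k < K ->
  (t * k + r \in abacus t K m) = (k < m r).
Proof.
move=> rt kK; rewrite mem_filter mem_rev mem_iota /= add0n.
have t0 : 0 < t by apply: leq_ltn_trans rt.
rewrite mulnC divnMDl // divn_small // addn0 modnMDl modn_small //.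
by rewrite (_ : k * t + r < t * K) ?andbT //; nia.
Qed.

Lemma abacus_sorted (t K : nat) (m : nat -> nat) : sorted gtn (abacus t K m).
Proof.
apply: sorted_filter; first by move=> y x z /= xy yz; apply: ltn_trans xy.
by rewrite rev_sorted iota_ltn_sorted.
Qed.

Lemma big_nat_runners (t K : nat) (G : nat -> nat) :
  \sum_(0 <= x < t * K) G x = \sum_(r < t) \sum_(k < K) G (t * k + r).
Proof.
elim: K => [|K IH]; first by rewrite muln0 big_geq // big1 // => r _; rewrite big_ord0.
rewrite mulnS (big_cat_nat (n := t * K)) ?leq_addl //= IH.
under [RHS]eq_bigr do rewrite big_ord_recr.
rewrite [RHS]big_split /=; congr (_ + _).
rewrite -{1}[t * K]add0n big_addn addnK big_mkord.
by apply: eq_bigr => i _; rewrite addnC.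
Qed.

Lemma sum_abacus (t K : nat) (m F : nat -> nat) :
  0 < t -> (forall r, r < t -> m r <= K) ->
  \sum_(x <- abacus t K m) F x = \sum_(r < t) \sum_(k < m r) F (t * k + r).
Proof.
move=> t0 mK; rewrite big_filter (perm_big (iota 0 (t * K))) ?perm_rev //=.
rewrite big_mkcond -[t * K]subn0 -/(index_iota 0 (t * K)) big_nat_runners.
apply: eq_bigr => r _; rewrite (big_ord_widen K (fun k => F (t * k + r)) (mK _ (ltn_ord r))).
rewrite [RHS]big_mkcond; apply: eq_bigr => k _.
by rewrite mulnC divnMDl // divn_small // addn0 modnMDl modn_small.
Qed.

(** A member [x] brings along the [x + 1] distinct members [0, ..., x], so [x < size s]; equality of
    cardinalities then makes [s] the whole initial segment. *)
Lemma mem_downclosed (s : seq nat) (k : nat) : uniq s ->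
  (forall k, k.+1 \in s -> k \in s) -> (k \in s) = (k < size s).
Proof.
move=> s_uniq clos.
have down j i : i + j \in s -> i \in s.
  by elim: j i => [|j IH] i; rewrite ?addn0 // addnS => /clos/IH.
have sub : {subset s <= iota 0 (size s)}.
  move=> x xs; rewrite mem_iota /= add0n.
  rewrite -[x.+1](size_iota 0); apply: uniq_leq_size; first exact: iota_uniq.
  move=> y; rewrite mem_iota add0n /= ltnS => yx.
  by apply: (down (x - y)); rewrite subnKC.
have [|_ ->] := uniq_min_size s_uniq sub; first by rewrite size_iota.
by rewrite mem_iota add0n.
Qed.

Definition runner (t : nat) (s : seq nat) (r : nat) : seq nat :=
  [seq x %/ t | x <- s & x %% t == r].

Lemma mem_runner (t : nat) (s : seq nat) (r k : nat) : r < t ->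
  (k \in runner t s r) = (t * k + r \in s).
Proof.
move=> rt; have t0 : 0 < t by apply: leq_ltn_trans rt.
apply/mapP/idP => [[x]|xs].
  by rewrite mem_filter => /andP[/eqP<- xs] ->; rewrite mulnC -divn_eq.
exists (t * k + r); last by rewrite mulnC divnMDl // divn_small // addn0.
by rewrite mem_filter xs mulnC modnMDl modn_small // eqxx.
Qed.

Lemma runner_uniq (t : nat) (s : seq nat) (r : nat) : uniq s -> uniq (runner t s r).
Proof.
move=> s_uniq; rewrite map_inj_in_uniq ?filter_uniq // => x y.
rewrite !mem_filter => /andP[/eqP xr _] /andP[/eqP yr _] xy.
by rewrite (divn_eq x t) (divn_eq y t) xr yr xy.
Qed.

Lemma runner_bound (t K : nat) (s : seq nat) (r : nat) : 0 < t -> uniq s ->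
  (forall x, x \in s -> x < t * K) -> size (runner t s r) <= K.
Proof.
move=> t0 s_uniq sK; rewrite -[K](size_iota 0).
apply: uniq_leq_size; first exact: runner_uniq.
move=> k /mapP[x]; rewrite mem_filter => /andP[_ /sK xK] ->.
by rewrite mem_iota add0n ltn_divLR // mulnC.
Qed.

(** Closure under subtracting [t] makes every runner an initial segment, hence determined by its
    length. Both lists are strictly decreasing, so having the same members suffices. *)
Lemma abacus_runner (t K : nat) (s : seq nat) : 0 < t -> sorted gtn s ->
  (forall x, x \in s -> x < t * K) -> (forall x, x + t \in s -> x \in s) ->
  abacus t K (fun r => size (runner t s r)) = s.
Proof.
move=> t0 s_sorted sK clos.
have gt_trans : transitive gtn by move=> y x z /= xy yz; apply: ltn_trans xy.
have gt_irr : irreflexive gtn by move=> x /=; rewrite ltnn.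
apply: (irr_sorted_eq gt_trans gt_irr) => //; first exact: abacus_sorted.
have s_uniq := sorted_uniq gt_trans gt_irr s_sorted.
move=> x; have rt := ltn_pmod x t0.
have E : t * (x %/ t) + x %% t = x by rewrite mulnC -divn_eq.
have [xK|Kx] := ltnP x (t * K); last first.
  have -> : x \in s = false by apply/negP => /sK; rewrite ltnNge Kx.
  by rewrite mem_filter mem_rev mem_iota add0n [x < _]ltnNge Kx !andbF.
rewrite -{1}E mem_abacus //; last by rewrite ltn_divLR // mulnC.
rewrite -mem_downclosed ?runner_uniq //; first by rewrite mem_runner // E.
move=> k; rewrite !mem_runner // mulnS => kt; apply: clos.
by rewrite addnC addnA.
Qed.

(* The entry m r is the number of beads (t+1) k + r on runner r. *)
Definition core_vectors (t n : nat) : {set {ffun 'I_t.+1 -> 'I_(2 * n).+1}} :=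
  [set m : {ffun 'I_t.+1 -> 'I_(2 * n).+1} | (\sum_r m r == t.+1 * n) &&
     (\sum_r \sum_(k < m r) (t.+1 * k + r) == n + \sum_(i < t.+1 * n) i)].

(** * Bijection between cores and vectors of runner lengths *)

Section CoreVectors.

Variables t n : nat.
Local Notation T := (t.+1).
Local Notation K := (2 * n).

(** The number of runners is a successor so that [inord] can turn a residue into an index. *)
Definition beads (m : {ffun 'I_T -> 'I_K.+1}) : seq nat :=
  abacus T K (fun r => m (inord r)).

(** Applied with [F] constantly 1 to count the beads, and with the identity to add up their
    positions. *)
Lemma sum_beads (m : {ffun 'I_T -> 'I_K.+1}) (F : nat -> nat) :
  \sum_(x <- beads m) F x = \sum_r \sum_(k < m r) F (T * k + r).
Proof.
rewrite sum_abacus // => [|r _]; last by rewrite -ltnS.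
by apply: eq_bigr => r _; rewrite inord_val.
Qed.

Lemma size_beads (m : {ffun 'I_T -> 'I_K.+1}) : size (beads m) = \sum_r m r.
Proof.
by rewrite -sum1_size sum_beads; apply: eq_bigr => r _; rewrite sum1_card card_ord.
Qed.

Lemma beads_inj : injective beads.
Proof.
move=> m1 m2 E; apply/ffunP => r; apply/val_inj => /=.
have mem (k : nat) : k < K -> (k < m1 r) = (k < m2 r).
  move=> kK; have A (m : {ffun 'I_T -> 'I_K.+1}) : (k < m r) = (T * k + r \in beads m).
    by rewrite mem_abacus // inord_val.
  by rewrite !A E.
have := ltn_ord (m1 r); have := ltn_ord (m2 r); rewrite !ltnS => b2 b1.
by have := mem (m1 r); have := mem (m2 r); lia.
Qed.

Lemma beads_closed (m : {ffun 'I_T -> 'I_K.+1}) (x : nat) :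
  x + T \in beads m -> x \in beads m.
Proof.
rewrite !mem_filter !mem_rev !mem_iota modnDr divnDr // divnn /=.
by move=> /andP[? ?]; apply/andP; split; lia.
Qed.

Lemma core_of_vector (m : {ffun 'I_T -> 'I_K.+1}) : m \in core_vectors t n ->
  is_partition_of n (part_of_beta (beads m)) && is_core T (part_of_beta (beads m)).
Proof.
rewrite inE -size_beads -(sum_beads m id) -sumnE => /andP[/eqP sz /eqP sm].
have s_sorted : sorted gtn (beads m) by apply: abacus_sorted.
set la := part_of_beta _.
have bE : beta (T * n) la = beads m by rewrite -sz part_of_betaK.
have la_sz : size la <= T * n by rewrite -sz size_part_of_beta.
have la_n : is_partition_of n la.
  rewrite /is_partition_of part_of_beta_partition //.
  by have := sumn_beta (T * n) la la_sz; rewrite bE sm => /addIn/esym/eqP.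
rewrite la_n; apply/(is_core_beta (T * n) la) => //.
- exact: part_of_beta_sorted.
- have [_] := partition_bounds la_n.
  by apply: sub_all => x xn; rewrite (leq_trans xn) // leq_pmull.
- by rewrite bE; apply: beads_closed.
Qed.

Lemma vector_of_core (la : seq nat) :
  is_partition_of n la -> is_core T la ->
  exists2 m, m \in core_vectors t n & la = part_of_beta (beads m).
Proof.
move=> la_n la_core.
have [la_p sm] := andP la_n; have [la_sorted _] := andP la_p.
have [sz bd] := partition_bounds la_n.
have nL : n <= T * n by rewrite leq_pmull.
have la_sz := leq_trans sz nL.
have la_bd : all (leq^~ (T * n)) la.
  by apply: sub_all bd => x xn; rewrite (leq_trans xn).
set s := beta (T * n) la.
have s_sorted : sorted gtn s by apply: beta_sorted.
(* The bound [2 * (T * n)] on positions is [T * K], so each runner has at most [K] beads and its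
   length fits in ['I_K.+1]. *)
have s_bd x : x \in s -> x < T * K.
  by rewrite mulnCA; apply: beta_bound.
have clos : forall x, x + T \in s -> x \in s.
  by apply/is_core_beta.
pose m : {ffun 'I_T -> 'I_K.+1} := [ffun r : 'I_T => inord (size (runner T s r))].
have mE (r : 'I_T) : m r = size (runner T s r) :> nat.
  rewrite ffunE inordK // ltnS; apply: runner_bound => //.
  exact: beta_uniq.
have sE : beads m = s.
  rewrite -[RHS](@abacus_runner T K) //; apply: eq_filter => x.
  by rewrite mE inordK // ltn_pmod.
exists m; last by rewrite sE betaK.
rewrite inE -size_beads -(sum_beads m id) -sumnE sE size_mkseq eqxx.
by rewrite sumn_beta // (eqP sm) eqxx.
Qed.

(** The map sending [m] to [part_of_beta (beads m)] lists the cores without repetition: all vectors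
    have [T * n] beads, so applying [beta] with that length recovers the beads from the
    partition. *)
Lemma num_cores_vectors : num_cores T n = #|core_vectors t n|.
Proof.
rewrite cardE -(size_map (fun m => part_of_beta (beads m))).
apply: num_coresP.
  rewrite map_inj_in_uniq ?enum_uniq // => m1 m2; rewrite !mem_enum !inE.
  rewrite -!size_beads => /andP[/eqP sz1 _] /andP[/eqP sz2 _] E.
  apply: beads_inj.
  have := part_of_betaK _ (abacus_sorted T K (fun r => m1 (inord r))).
  have := part_of_betaK _ (abacus_sorted T K (fun r => m2 (inord r))).
  by rewrite -!/(beads _) E sz1 sz2 => ->.
move=> la; apply/mapP/andP => [[m]|[la_n la_core]].
  by rewrite mem_enum => /core_of_vector/andP[? ?] ->.
by have [m mP ->] := vector_of_core la la_n la_core; exists m; rewrite ?mem_enum.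
Qed.

End CoreVectors.

(** * Parity by an involution *)

(** By induction on the cardinality, removing one pair [x], [f x] of distinct points at a time. *)
Lemma card_fixpoints_mod2 (T : finType) (f : T -> T) (A : {set T}) :
  involutive f -> (forall x, x \in A -> f x \in A) ->
  #|A| = #|[set x in A | f x == x]| %[mod 2].
Proof.
move=> fK; have [N] := ubnP #|A|; elim: N A => // N IH A leN fA.
have [/existsP[x /andP[xA fx]]|] := boolP [exists x, (x \in A) && (f x != x)]; last first.
  rewrite negb_exists => /forallP fix_all; congr (#|pred_of_set _| %% 2).
  apply/setP => x; rewrite inE; case xA: (x \in A) => //=.
  by have := fix_all x; rewrite xA /= negbK.
have fxA : f x \in A :\ x by rewrite !inE fx fA.
have cA : #|A| = #|A :\ x :\ f x|.+2.
  by rewrite (cardsD1 x) xA (cardsD1 (f x) (A :\ x)) fxA.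
rewrite cA -addn2 modnDr IH.
- congr (#|pred_of_set _| %% 2); apply/setP => y; rewrite !inE.
  have [->|yx] := eqVneq y x; first by rewrite (negPf fx) !andbF.
  by have [->|//] := eqVneq y (f x); rewrite fK eq_sym (negPf fx) !andbF.
- by move: leN; rewrite cA; lia.
- move=> y; rewrite !inE (inj_eq (inv_inj fK)) => /and3P[yfx yx yA].
  by rewrite yx fA // andbT; apply: contra yfx => /eqP<-; rewrite fK.
Qed.

(** * Sums of two squares and powers of 3 *)

(** Squares are 0 or 1 modulo 3, so a sum of two vanishes only if both do. *)
Lemma dvdn3_sum_squares (x y : nat) : 3 %| x ^ 2 + y ^ 2 -> (3 %| x) && (3 %| y).
Proof.
rewrite /dvdn -modnDm -[x ^ 2 %% 3]modnXm -[y ^ 2 %% 3]modnXm.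
have := ltn_pmod x (isT : 0 < 3); have := ltn_pmod y (isT : 0 < 3).
by case: (x %% 3) => [|[|[|]]] //; case: (y %% 3) => [|[|[|]]].
Qed.

Lemma sum_squares_descent (a w x y : nat) : x ^ 2 + y ^ 2 = 9 ^ a * w ->
  exists x' y', [/\ x = 3 ^ a * x', y = 3 ^ a * y' & x' ^ 2 + y' ^ 2 = w].
Proof.
elim: a x y => [|a IH] x y E; first by exists x, y; split; lia.
have /dvdn3_sum_squares/andP[/dvdnP[u xE] /dvdnP[v yE]] : 3 %| x ^ 2 + y ^ 2.
  by rewrite E expnS -mulnA dvdn_mulr.
have /IH[u' [v' [uE vE <-]]] : u ^ 2 + v ^ 2 = 9 ^ a * w.
  move: E; rewrite xE yE !expnMn -mulnDl (expnS 9) -mulnA mulnC => /eqP.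
  by rewrite eqn_pmul2l // => /eqP.
by exists u', v'; rewrite xE yE uE vE !expnS; split=> //; lia.
Qed.

(** After descent, [3 * w] is a sum of two squares; both roots are divisible by 3, so 9 divides
    [3 * w]. *)
Lemma sum_squares_odd_power3 (a w x y : nat) :
  x ^ 2 + y ^ 2 = 9 ^ a * (3 * w) -> 3 %| w.
Proof.
case/sum_squares_descent => u [v [_ _ E]].
have /dvdn3_sum_squares/andP[/dvdnP[p uE] /dvdnP[q vE]] : 3 %| u ^ 2 + v ^ 2.
  by rewrite E dvdn_mulr.
by apply/dvdnP; exists (p ^ 2 + q ^ 2); move: E; rewrite uE vE !expnMn; lia.
Qed.

Lemma sum_squares_ten (x y : nat) : x ^ 2 + y ^ 2 = 10 ->
  (x, y) = (1, 3) \/ (x, y) = (3, 1).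
Proof.
move=> E; have x4 : x < 4 by nia.
have y4 : y < 4 by nia.
by move: x x4 y y4 E => [|[|[|[|]]]] // _ [|[|[|[|]]]] //; auto.
Qed.

Lemma exp3_mod8 (k : nat) : exists q, 3 ^ k = 8 * q + 1 \/ 3 ^ k = 8 * q + 3.
Proof.
elim: k => [|k [q [IH|IH]]]; first by exists 0; left.
- by exists (3 * q); right; rewrite expnS IH; lia.
- by exists (3 * q + 1); left; rewrite expnS IH; lia.
Qed.

(* Here x = |8 u - 3| and y = |8 v - 1| for a = n + u and b = n + v. *)
Lemma vector_squares (n a b c d : nat) : a + d = 2 * n -> b + c = 2 * n ->
  2 * (a * a + b * b + c * c + d * d) + b + 2 * c + 3 * d = 8 * (n * n) + 7 * n ->
  exists x y, [/\ x ^ 2 + y ^ 2 = 16 * n + 10,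
    8 * a = 8 * n + 3 + x \/ 8 * a + x = 8 * n + 3 &
    8 * b = 8 * n + 1 + y \/ 8 * b + y = 8 * n + 1].
Proof.
move=> ad bc E.
have [x xE] : exists x, 8 * a = 8 * n + 3 + x \/ 8 * a + x = 8 * n + 3.
  (* The sum of the two truncated differences is the absolute value. *)
  by exists ((8 * a - (8 * n + 3)) + (8 * n + 3 - 8 * a)); lia.
have [y yE] : exists y, 8 * b = 8 * n + 1 + y \/ 8 * b + y = 8 * n + 1.
  by exists ((8 * b - (8 * n + 1)) + (8 * n + 1 - 8 * b)); lia.
exists x, y; split=> //.
by case: xE => xE; case: yE => yE; nia.
Qed.

(** * Conjugation on vectors of 4-cores *)

(** Conjugation reverses the positions and swaps beads with gaps. The outer [rev_ord] is the
    complement to [2 * n], the inner one the reversal of the runners. *)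
Definition conj_vector (t n : nat) (m : {ffun 'I_t.+1 -> 'I_(2 * n).+1}) :
    {ffun 'I_t.+1 -> 'I_(2 * n).+1} :=
  [ffun r => rev_ord (m (rev_ord r))].

Lemma conj_vectorK (t n : nat) : involutive (@conj_vector t n).
Proof. by move=> m; apply/ffunP => r; rewrite !ffunE !rev_ordK. Qed.

Local Notation o k := (@Ordinal 4 k isT).

Lemma sum_ord4 (F : 'I_4 -> nat) :
  \sum_r F r = F (o 0) + F (o 1) + F (o 2) + F (o 3).
Proof.
rewrite !big_ord_recl big_ord0 addn0 !addnA.
by do 3?congr (_ + _); congr F; apply: val_inj.
Qed.

(** The arithmetic series, doubled and with [t * m] moved to the left to avoid division and
    subtraction. *)
Lemma sum_runner (t r m : nat) :
  2 * (\sum_(k < m) (t * k + r)) + t * m = t * (m * m) + 2 * (r * m).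
Proof.
elim: m => [|m IH]; first by rewrite big_ord0 !muln0.
by rewrite big_ord_recr /=; move: (\sum_(k < m) _) IH => S IH; nia.
Qed.

Lemma mem_core_vectors4 (n : nat) (m : {ffun 'I_4 -> 'I_(2 * n).+1}) :
  let a := m (o 0) : nat in let b := m (o 1) : nat in
  let c := m (o 2) : nat in let d := m (o 3) : nat in
  (m \in core_vectors 3 n) = (a + b + c + d == 4 * n) &&
    (2 * (a * a + b * b + c * c + d * d) + b + 2 * c + 3 * d
       == 8 * (n * n) + 7 * n).
Proof.
move=> a b c d; rewrite inE !sum_ord4 /= -/a -/b -/c -/d.
(* The triangular sum in the size condition is also an instance of [sum_runner], with [t = 1] and
   [r = 0]. *)
have E1 : \sum_(k < 4 * n) (1 * k + 0) = \sum_(k < 4 * n) k.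
  by apply: eq_bigr => k _; rewrite mul1n addn0.
have := sum_runner 1 0 (4 * n); rewrite {}E1.
clearbody a b c d; have := sum_runner 4 3 d; have := sum_runner 4 2 c.
have := sum_runner 4 1 b; have := sum_runner 4 0 a.
move: (\sum_(k < a) _) (\sum_(k < b) _) (\sum_(k < c) _) (\sum_(k < d) _).
move: (\sum_(k < 4 * n) _) => S A B C D EA EB EC ED ES.
by apply: andb_id2l => /eqP N; apply/eqP/eqP; lia.
Qed.

Lemma conj_core_vectors4 (n : nat) (m : {ffun 'I_4 -> 'I_(2 * n).+1}) :
  m \in core_vectors 3 n -> conj_vector 3 n m \in core_vectors 3 n.
Proof.
rewrite !mem_core_vectors4 !ffunE.
have -> : rev_ord (o 0) = o 3 by apply: val_inj.
have -> : rev_ord (o 1) = o 2 by apply: val_inj.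
have -> : rev_ord (o 2) = o 1 by apply: val_inj.
have -> : rev_ord (o 3) = o 0 by apply: val_inj.
case: (m _) (m _) (m _) (m _) => [a /= la] [b /= lb] [c /= lc] [d /= ld].
rewrite !subSS !ltnS in la lb lc ld *.
have sq x : x <= 2 * n -> (2 * n - x) * (2 * n - x) + 4 * (n * x) = 4 * (n * n) + x * x.
  by move=> /subnKC; move: (2 * n - x) => y E; nia.
(* [S'] relates the cross terms [n * x] that [sq] introduces, so that the goal is linear in the
   products. *)
move=> /andP[/eqP S /eqP Q]; have S' := congr1 (muln n) S.
have := sq a; have := sq b; have := sq c; have := sq d.
by move=> sd sc sb sa; apply/andP; split; apply/eqP; lia.
Qed.

Definition self_conj_vectors (n : nat) : {set {ffun 'I_4 -> 'I_(2 * n).+1}} :=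
  [set m in core_vectors 3 n | conj_vector 3 n m == m].

Lemma num_cores4_mod2 (n : nat) :
  num_cores 4 n = #|self_conj_vectors n| %[mod 2].
Proof.
rewrite num_cores_vectors; apply: card_fixpoints_mod2; first exact: conj_vectorK.
exact: conj_core_vectors4.
Qed.

Lemma conj_vector4_eq (n : nat) (m : {ffun 'I_4 -> 'I_(2 * n).+1}) :
  (conj_vector 3 n m == m) =
    (m (o 0) + m (o 3) == 2 * n) && (m (o 1) + m (o 2) == 2 * n).
Proof.
have r0 : rev_ord (o 0) = o 3 by apply: val_inj.
have r1 : rev_ord (o 1) = o 2 by apply: val_inj.
have r2 : rev_ord (o 2) = o 1 by apply: val_inj.
have r3 : rev_ord (o 3) = o 0 by apply: val_inj.
have l0 := ltn_ord (m (o 0)); have l1 := ltn_ord (m (o 1)).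
have l2 := ltn_ord (m (o 2)); have l3 := ltn_ord (m (o 3)).
apply/eqP/andP => [/ffunP E | [/eqP E0 /eqP E1]].
  have /(congr1 val) := E (o 0); have /(congr1 val) := E (o 1).
  by rewrite !ffunE r0 r1 /= => ? ?; split; apply/eqP; lia.
apply/ffunP; case=> [[|[|[|[|]]]] // k]; apply: val_inj; rewrite ffunE (bool_irrelevance k isT).
- by rewrite r0 /=; lia.
- by rewrite r1 /=; lia.
- by rewrite r2 /=; lia.
- by rewrite r3 /=; lia.
Qed.

Lemma self_conj_vector_squares (n : nat) (m : {ffun 'I_4 -> 'I_(2 * n).+1}) :
  m \in self_conj_vectors n ->
  exists x y, [/\ x ^ 2 + y ^ 2 = 16 * n + 10,
    8 * m (o 0) = 8 * n + 3 + x \/ 8 * m (o 0) + x = 8 * n + 3 &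
    8 * m (o 1) = 8 * n + 1 + y \/ 8 * m (o 1) + y = 8 * n + 1].
Proof.
rewrite inE mem_core_vectors4 conj_vector4_eq.
move=> /andP[/andP[_ /eqP Q] /andP[/eqP ad /eqP bc]].
exact: vector_squares ad bc Q.
Qed.

(** * Counting self-conjugate vectors *)

Lemma self_conj_vectors0 (n a w : nat) : 8 * n + 5 = 9 ^ a * (3 * w) ->
  ~~ (3 %| w) -> #|self_conj_vectors n| = 0.
Proof.
move=> E w3; apply/eqP; rewrite cards_eq0; apply/eqP/setP => m; rewrite [RHS]inE.
apply/negP => /self_conj_vector_squares[x [y [xy _ _]]].
have : 3 %| 2 * w by apply: (sum_squares_odd_power3 a _ x y); rewrite xy; lia.
by rewrite Euclid_dvdM // (negPf w3).
Qed.

(** Descent leaves [3 ^ b] and [3 * 3 ^ b] as the two roots. One root must be 3 or -3 and the other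
    1 or -1 modulo 8, so the residue of [3 ^ b] decides which is which. *)
Lemma self_conj_vectors1 (n b : nat) : 8 * n + 5 = 5 * 9 ^ b ->
  #|self_conj_vectors n| = 1.
Proof.
move=> E; have [q qE] := exp3_mod8 b.
have sq : 9 ^ b = 3 ^ b * 3 ^ b by rewrite mulnn expnAC.
(* r = - u and s = - v; the residues of 3^b mod 8 force u, v <= 0. *)
have [r [s [nE rsE]]] : exists r s, n = 4 * (r * r) + 3 * r + 4 * (s * s) + s /\
    ((3 ^ b = 8 * s + 1 /\ r = 3 * s) \/ (3 ^ b = 8 * r + 3 /\ s = 3 * r + 1)).
  case: qE => qE; rewrite sq qE in E.
  - by exists (3 * q), q; split; [nia | by left].
  - by exists q, (3 * q + 1); split; [nia | by right].
have rn : r <= n by lia.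
have sn : s <= n by lia.
pose v (k : nat) : nat := nth 0 [:: n - r; n - s; n + s; n + r] k.
have vK k : v k < (2 * n).+1.
  by case: k => [|[|[|[|k]]]]; rewrite /v /= ?nth_nil //; lia.
pose m0 : {ffun 'I_4 -> 'I_(2 * n).+1} := [ffun k : 'I_4 => Ordinal (vK k)].
have m0_in : m0 \in self_conj_vectors n.
  rewrite inE mem_core_vectors4 conj_vector4_eq !ffunE /= /v /=.
  (* With the differences named, the multiples of [r + c = n] and [s + d = n] supply the quadratic
     relations that [nia] needs. *)
  have := subnKC rn; have := subnKC sn; move: (n - r) (n - s) => c d dE cE.
  have := congr1 (muln r) cE; have := congr1 (muln s) dE.
  have := congr1 (muln c) cE; have := congr1 (muln d) dE => {vK m0 E sq qE rsE} ? ? ? ?.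
  apply/andP; split; apply/andP; split; apply/eqP; nia.
apply/eqP/cards1P; exists m0; apply/setP => m; rewrite [RHS]inE.
apply/idP/eqP => [mS|->//].
have [x [y [xy xE yE]]] := self_conj_vector_squares _ _ mS.
have [|x' [y' [x'E y'E]]] := sum_squares_descent b 10 x y; first by rewrite xy; lia.
move=> /sum_squares_ten xy'.
move: mS; rewrite inE conj_vector4_eq => /andP[_ /andP[/eqP E03 /eqP E12]].
have [E0 E1 E2 E3] : [/\ m (o 0) = n - r :> nat, m (o 1) = n - s :> nat,
    m (o 2) = n + s :> nat & m (o 3) = n + r :> nat].
  (* Once the power and the entries are generalized everything is linear; the wrong order of the
     roots and the wrong signs contradict divisibility by 8. *)
  move: rn sn rsE E03 E12 xE yE x'E y'E; case: xy' => -[-> ->]; clear;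
  move: (3 ^ b) (m (o 0) : nat) (m (o 1) : nat) (m (o 2) : nat) (m (o 3) : nat);
  by move=> *; split; lia.
by apply/ffunP; case=> [[|[|[|[|]]]] // k]; apply: val_inj;
  rewrite (bool_irrelevance k isT) ffunE.
Qed.

Theorem mainTheorem8 :
  (forall alpha n i : nat, 1 <= alpha -> i \in [:: 1; 2] ->
     num_cores 4 (3 ^ (2 * alpha) * n
                  + ((8 * i + 15) * 3 ^ (2 * alpha - 1) - 5) %/ 8)
       = 0 %[mod 2])
  /\
  (forall beta : nat,
     num_cores 4 ((5 * 3 ^ (2 * beta) - 5) %/ 8) = 1 %[mod 2]).
Proof.
split=> [alpha n i a1 i12 | b].
  (* For this index [N], [8 * N + 5 = 8 * 9 ^ alpha * n + (8 * i + 15) * 3 ^ (2 * alpha - 1)];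
     taking out [9 ^ alpha.-1 * 3] leaves the given cofactor. *)
  rewrite num_cores4_mod2 (self_conj_vectors0 _ alpha.-1 (24 * n + (8 * i + 15))) //.
    rewrite mulnDr -addnA index_exact //; case: alpha a1 => // a _.
    rewrite mulnS add2n subSS subn0 !(expnS 3) expnM /=.
    by move: (9 ^ a) => p; lia.
  (* Modulo 3 the cofactor reduces to [8 * i + 15], which is 23 or 31. *)
  by move: i12; rewrite !inE => /orP[] /eqP->; rewrite dvdn_addr ?dvdn_mulr.
rewrite num_cores4_mod2 (self_conj_vectors1 _ b) //.
by rewrite odd_index_exact expnM.
Qed.
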